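(* Let $\mathcal{B}\in\mathcal{A}^q$ be a non-empty system and let $R\in\mathbb{R}^{g\times q}[\xi]$ be a polynomial matrix. Then there exists $c\in\mathbb{R}^g$ such that $$\mathcal{B}=\{w\in(\mathbb{R}^q)^{\mathbb{Z}} \mid R(\sigma)w=c\}$$ if and only if $$\mathcal{B}_{\mathrm{dif}}=\{w\in(\mathbb{R}^q)^{\mathbb{Z}}\mid R(\sigma)w=0\}.$$
   Context: A system (behavior) is a subset $\mathcal{B}\subseteq(\mathbb{R}^q)^{\mathbb{Z}}$ of two-sided sequences. The shift is $(\sigma w)(t)=w(t+1)$. $\mathcal{B}$ is affine if $v,w\in\mathcal{B}$, $\alpha\in\mathbb{R}$ imply $\alpha v+(1-\alpha)w\in\mathcal{B}$; time-invariant if $\sigma\mathcal{B}=\mathcal{B}$; complete if $w\in\mathcal{B}$ holds if and only if $w|_{[t_0,t_1]}\in\mathcal{B}|_{[t_0,t_1]}$ for all integers $t_0<t_1$, where $\mathcal{B}|_{[t_0,t_1]}$ is the set of restrictions to $[t_0,t_1]$ of elements of $\mathcal{B}$. $\mathcal{A}^q$ is the class of all complete affine time-invariant systems $\mathcal{B}\subseteq(\mathbb{R}^q)^{\mathbb{Z}}$. The difference system is $\mathcal{B}_{\mathrm{dif}}:=\mathcal{B}-\mathcal{B}=\{a-b\mid a,b\in\mathcal{B}\}$. $\mathbb{R}^{g\times q}[\xi]$ is the set of $g\times q$ matrices with entries real polynomials in $\xi$; for $R(\xi)=R_0+R_1\xi+\dots+R_d\xi^d$, $(R(\sigma)w)(t)=\sum_{i=0}^d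 R_i w(t+i)$. A vector $c\in\mathbb{R}^g$ is identified with the constant sequence with value $c$. *)

(* Defs.v *)
From mathcomp Require Import all_boot all_order all_algebra.
From mathcomp Require Import boolp classical_sets functions reals.

Import Order.TTheory GRing.Theory Num.Theory.

Local Open Scope classical_set_scope.
Local Open Scope ring_scope.

Section Behaviors.
Context {R : realType} {q : nat}.

Implicit Types (B : set (int -> 'cV[R]_q)) (w : int -> 'cV[R]_q).

Definition shift w : int -> 'cV[R]_q := fun t => w (t + 1).

Definition affine_system B : Prop :=
  forall v w (a : R), B v -> B w -> B (a *: v + (1 - a) *: w).

Definition time_invariant B : Prop := shift @` B = B.

Definition window (t0 t1 : int) : Type := {t : int | t0 <= t <= t1}.

Definition restriction (t0 t1 : int) w : window t0 t1 -> 'cV[R]_q :=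
  fun t => w (sval t).

Definition complete_system B : Prop :=
  forall w, B w <-> (forall t0 t1 : int, t0 < t1 ->
    (restriction t0 t1 @` B) (restriction t0 t1 w)).

(* The class A^q; the empty system belongs to it. *)
Definition affine_behavior B : Prop :=
  [/\ complete_system B, affine_system B & time_invariant B].

Definition difference_system B : set (int -> 'cV[R]_q) :=
  [set a - b | a in B & b in B].

End Behaviors.

Section PolynomialOperators.
Context {R : realType} {g q : nat}.
Implicit Types (P : 'M[{poly R}]_(g, q)) (w : int -> 'cV[R]_q).

Definition coef_pmx P (k : nat) : 'M[R]_(g, q) := map_mx (coefp k) P.

(* One more than the largest degree of an entry: this is d + 1 for
   P = P_0 + P_1 'X + ... + P_d 'X^d with P_d != 0, and 0 for P = 0. *)
Definition size_pmx P : nat := \max_(i < g) \max_(j < q) size (P i j).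

Definition shift_op P w : int -> 'cV[R]_g :=
  fun t => \sum_(k < size_pmx P) coef_pmx P k *m w (t + k%:Z).

End PolynomialOperators.

(* Main.v *)
(* If a, b, w0 lie in an affine system, so does w0 + a - b; hence such a system
   is a translate w0 + B_dif.  Time-invariance gives sigma w0 - w0 in
   B_dif = ker R(sigma), so R(sigma) w0 is shift-invariant, i.e. constant. *)
Require Import Defs.
From mathcomp Require Import all_boot all_order all_algebra.
From mathcomp Require Import boolp classical_sets functions reals.
From mathcomp Require Import ring.

Import Order.TTheory GRing.Theory Num.Theory.

Local Open Scope classical_set_scope.
Local Open Scope ring_scope.

Lemma shift_invariant_cst (T : Type) (f : int -> T) :
  (forall t, f (t + 1) = f t) -> f = cst (f 0).
Proof.
move=> f1; apply/funext; rewrite /cst.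
(* Induction on integers runs outwards from 0 in both directions; on the negative side the
   hypothesis is read at [t = - n.+1]. *)
elim=> [//|n <-|n <-]; first by rewrite intS addrC f1.
by rewrite -f1 intS opprD addrC addNKr.
Qed.

Lemma shift_opB (R : realType) (g q : nat) (P : 'M[{poly R}]_(g, q))
    (v w : int -> 'cV[R]_q) :
  shift_op P (v - w) = shift_op P v - shift_op P w.
Proof.
apply/funext => t; rewrite -[RHS]sumrB.
by apply: eq_bigr => k _; rewrite -mulmxBr.
Qed.

Lemma shift_op_shift (R : realType) (g q : nat) (P : 'M[{poly R}]_(g, q))
    (w : int -> 'cV[R]_q) :
  shift_op P (shift w) = fun t => shift_op P w (t + 1).
Proof.
apply/funext => t; apply: eq_bigr => k _.
by rewrite /shift addrAC.
Qed.

(** Affinity only combines two points at a time, so two stages are used: with [m] the midpoint of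
    [w] and [a], the target is [2 m - b], the reflection of [b] in [m], whose weights 2 and -1 sum
    to 1. *)
Lemma affine_systemDB (R : realType) (q : nat) (B : set (int -> 'cV[R]_q))
    (w a b : int -> 'cV[R]_q) :
  affine_system B -> B w -> B a -> B b -> B (w + (a - b)).
Proof.
move=> affB Bw Ba Bb.
suff -> : w + (a - b)
    = 2 *: (2^-1 *: w + (1 - 2^-1) *: a) + (1 - 2) *: b
  by apply: (affB) => //; apply: affB.
have half : 2 * (1 - 2^-1) = 1 :> R by field.
have one : 1 - 2 = -1 :> R by ring.
by rewrite scalerDr !scalerA mulfV ?pnatr_eq0// half one !scale1r scaleN1r addrA.
Qed.

Theorem theorem4 (R : realType) (g q : nat) (B : set (int -> 'cV[R]_q))
    (P : 'M[{poly R}]_(g, q))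
    (hB : affine_behavior B) (B_nonempty : B !=set0) :
  (exists c : 'cV[R]_g, B = [set w | shift_op P w = cst c]) <->
  difference_system B = [set w | shift_op P w = 0].
Proof.
have [_ affB tiB] := hB; have [w0 Bw0] := B_nonempty.
split=> [[c Bc]|dB].
  apply/seteqP; split=> [_ [a Ba [b Bb <-]]|v /= Pv].
    by move: Ba Bb; rewrite Bc /= shift_opB => -> ->; rewrite subrr.
  (* Write [v = w0 - (w0 - v)]: since [v] is in the kernel, [w0 - v] still has image [c]. *)
  exists w0 => //; exists (w0 - v); last by rewrite opprB addrC subrK.
  by move: Bw0; rewrite Bc /= shift_opB Pv subr0.
(* All of [B] has one image, as differences of its elements lie in the kernel. *)
have dP a b : B a -> B b -> shift_op P a = shift_op P b.
  move=> Ba Bb; apply/eqP; rewrite -subr_eq0 -shift_opB; apply/eqP.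
  have : difference_system B (a - b) by exists a => //; exists b.
  by rewrite dB.
have Bsw0 : B (shift w0) by rewrite -tiB; exists w0.
have Pw0 : shift_op P w0 = cst (shift_op P w0 0).
  apply: shift_invariant_cst => t.
  by rewrite -[in RHS](dP _ _ Bsw0 Bw0) shift_op_shift.
exists (shift_op P w0 0); rewrite -Pw0.
apply/seteqP; split=> [w Bw|w /= Pw]; first exact: dP.
(* Equal images put [w - w0] in the kernel, so [w = w0 + (a - b)] with [a], [b] in [B]. *)
have : difference_system B (w - w0) by rewrite dB /= shift_opB Pw subrr.
case=> a Ba [b Bb abw].
by rewrite -(subrK w0 w) addrC -abw; apply: affine_systemDB.
Qed.
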